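(* Suppose $k\ge 4$ and $\Pi\subseteq\mathfrak S_k$ with $\#\Pi=2$. Then $Q_n(\Pi)$ is a symmetric function for all $n$ if and only if $\Pi=\{\iota_k,\delta_k\}$.
   Context: $\mathfrak S_n$ is the set of permutations $\pi=\pi_1\cdots\pi_n$ of $[n]=\{1,\dots,n\}$. The standardization of a sequence of distinct reals replaces its smallest element by $1$, the next smallest by $2$, etc. A permutation $\sigma$ contains $\pi$ if some (not necessarily contiguous) subsequence of $\sigma$ standardizes to $\pi$; otherwise it avoids $\pi$. $\mathfrak S_n(\Pi)$ is the set of $\sigma\in\mathfrak S_n$ avoiding every $\pi\in\Pi$. $\iota_k=12\cdots k$ and $\delta_k=k\cdots 21$ are the increasing and decreasing permutations in $\mathfrak S_k$. The descent set of $\sigma\in\mathfrak S_n$ is $\mathrm{Des}\,\sigma=\{i\in[n-1]\mid \sigma_i>\sigma_{i+1}\}$. For $S\subseteq[n-1]$ the fundamental quasisymmetric function (of degree $n$, in variables $x_1,x_2,\dots$ with real coefficients) is $F_S=\sum x_{i_1}x_{i_2}\cdots x_{i_n}$, the sum over all $i_1\le i_2\le\cdots\le i_n$ with $i_j<i_{j+1}$ whenever $j\in S$. Define $Q_n(\Pi)=\sum_{\sigma\in\mathfrak S_n(\Pi)}F_{\mathrm{Des}\,\sigma}$. *)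

(* Defs.v *)
From mathcomp Require Import all_boot all_order all_algebra all_fingroup.
From mathcomp Require Import finmap multiset.
From mathcomp Require Import boolp classical_sets functions cardinality fsbigop.
From mathcomp Require Import reals.
Set Implicit Arguments.
Unset Strict Implicit.
Unset Printing Implicit Defensive.
Import Order.TTheory GRing.Theory Num.Theory.
Local Open Scope nat_scope.

(** Permutations and pattern avoidance *)

(* 'S_n permutes {0, ..., n-1}; [oneline] shifts the values back to [n]. *)
Definition oneline (n : nat) (s : 'S_n) : seq nat :=
  [seq (val (s i)).+1 | i <- enum 'I_n].

(* Meant for words with distinct letters. *)
Definition standardization (w : seq nat) : seq nat :=
  [seq (count (fun y => y < x) w).+1 | x <- w].

Definition contains (n k : nat) (s : 'S_n) (p : 'S_k) : bool :=
  [exists m : n.-tuple bool,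
    standardization (mask m (oneline s)) == oneline p].

Definition avoiders (n k : nat) (Pi : {set 'S_k}) : {set 'S_n} :=
  [set s : 'S_n | [forall p in Pi, ~~ contains s p]].

Definition iota_perm (k : nat) : 'S_k := 1%g.

Definition delta_perm (k : nat) : 'S_k := perm (@rev_ord_inj k).

(* The position i in [n-1] is represented by i-1 : 'I_n.-1, so that the word
   has its entries number i and i+1 at the 0-based indices i-1 and i. *)
Definition Des (n : nat) (s : 'S_n) : {set 'I_n.-1} :=
  [set i : 'I_n.-1 | nth 0 (oneline s) i.+1 < nth 0 (oneline s) i].

(** Formal power series in x_1, x_2, ... *)

Local Open Scope mset_scope.

(* The natural number i stands for the variable x_(i+1), a multiset of naturals
   for a monomial, and a power series is its family of coefficients. *)
Definition power_series (R : realType) : Type := {mset nat} -> R.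

Definition rename_vars (w : nat -> nat) (m : {mset nat}) : {mset nat} :=
  seq_mset [seq w i | i <- enum_mset m].

Definition bounded_degree (R : realType) (f : power_series R) : Prop :=
  exists d : nat, forall m : {mset nat}, f m <> 0%R -> size (enum_mset m) <= d.

Definition symmetric_function (R : realType) (f : power_series R) : Prop :=
  bounded_degree f /\
  forall w : nat -> nat, bijective w ->
  forall m : {mset nat}, f (rename_vars w m) = f m.

(** Quasisymmetric functions *)

Definition F_indices (n : nat) (S : {set 'I_n.-1}) : set (n.-tuple nat) :=
  [set t : n.-tuple nat | sorted leq t /\
                            forall j : 'I_n.-1, j \in S -> nth 0 t j < nth 0 t j.+1]%classic.

(* The coefficient of m in the sum of the monomials x_(t_1) ... x_(t_n) over all
   t in [F_indices S].  Only the finitely many rearrangements t of m contribute,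
   so this sum with finite support is never the default value 0 that \sum_(_ \in _)
   takes on infinite supports. *)
Definition F (R : realType) (n : nat) (S : {set 'I_n.-1}) : power_series R :=
  fun m => (\sum_(t \in F_indices S) ((seq_mset t == m)%:R : R))%R.

Definition Q (R : realType) (n k : nat) (Pi : {set 'S_k}) : power_series R :=
  fun m => (\sum_(s in avoiders n Pi) F R (Des s) m)%R.

(* Main.v *)
From mathcomp Require Import boolp classical_sets fsbigop.
Require Import Defs.
From mathcomp Require Import all_boot all_order all_algebra all_fingroup.
From mathcomp Require Import finmap multiset.
From mathcomp Require Import reals zify.
Set Implicit Arguments.
Unset Strict Implicit.
Unset Printing Implicit Defensive.
Import Order.TTheory GRing.Theory Num.Theory.
Local Open Scope nat_scope.

(** The coefficient of [Q_n(Pi)] at a monomial of degree [n], read as a weakly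
    increasing word [t], is the number of [Pi]-avoiding permutations whose
    descents all sit at strict increases of [t] ([Q_coef]).  Symmetry says that
    this number does not change when the letters of [t] are renamed.

    The pair [iota_k], [delta_k] does give a symmetric function.  Sorting the
    two-row array of a rearrangement [w] of [t] (letters above positions) turns
    [w] into a permutation, the inverse of its standardization; this is a
    bijection from the rearrangements of [t] onto the permutations counted for
    the symmetric group ([perm_inv_std]).  The permutation avoids both patterns
    iff [w] has no weakly increasing and no strictly decreasing subsequence of
    length [k] ([has_strict_chain_inv_std]).  To exchange the multiplicities of
    two neighbouring letters [a] and [a + 1] among the words with that property,
    apply the crystal operator that turns a suitable letter [a] into [a + 1]
    as many times as the two multiplicities differ.  It is injective, and it
    preserves the lengths of both kinds of subsequences because it acts between
    two blocks in which the other occurrences of [a] and [a + 1] are balanced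
    ([lowerP], [has_chain_crystal_invariant]).  Neighbouring exchanges generate
    all renamings ([word_count_rename]).

    Conversely, let [Pi = {p, q}] and [n = k].  All permutations together give a
    symmetric function, and [p] and [q] are the only ones that fail to avoid
    [Pi]; so [F_{Des p} + F_{Des q}] is symmetric ([symmetric_pair_compatible]).
    Its coefficient at a word with a single repeated letter counts which of [p]
    and [q] ascend at one given position, so this count is the same at every
    position.  If it is 0 or 2, then [p] and [q] are the same monotone permutation,
    which is absurd; so it is 1, and the two descent sets are complementary.  A
    letter of multiplicity three compares neighbouring positions: either [p] and
    [q] are monotone, or their ascents alternate.  For [k >= 5] two doubled letters
    rule out alternation ([complementary_ascents]).  For [k = 4] the alternating case is genuinely
    symmetric in degree 4, because [F_{2} + F_{1,3}] is the Schur function of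
    the shape (2,2).  It concerns 25 pairs, and the coefficients in degree 6 at
    the exponents (1,1,2,2), (1,2,1,2) and (1,2,2,1) refute each of them
    ([separated]).  Two distinct monotone permutations are [iota_k] and
    [delta_k]. *)

(** * Subsequences *)

Fixpoint subseqs (T : Type) (s : seq T) : seq (seq T) :=
  if s is x :: s' then [seq x :: y | y <- subseqs s'] ++ subseqs s'
  else [:: [::]].

Lemma mem_subseqs (T : eqType) (x s : seq T) : (x \in subseqs s) = subseq x s.
Proof.
elim: s x => [|a s IHs] x; first by case: x.
rewrite [subseqs _]/= mem_cat IHs; case: x => [|b x]; first by rewrite !sub0seq orbT.
rewrite [in RHS]/=; case: eqP => [->|ne_ba].
  rewrite mem_map ?IHs => [|? ? [] //]; apply/orb_idr => bx_s.
  exact: subseq_trans (subseq_cons x a) bx_s.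
by apply/orb_idl => /mapP[y _ [/ne_ba]].
Qed.

Lemma subseq_cat_split (T : eqType) (s1 s2 s : seq T) :
  subseq (s1 ++ s2) s ->
  exists t1 t2, [/\ s = t1 ++ t2, subseq s1 t1 & subseq s2 t2].
Proof.
elim: s s1 => [|x s IHs] [|y s1] /=.
- by move=> s2_0; exists [::], [::].
- by [].
- by move=> s2_s; exists [::], (x :: s).
case: eqP => [->|ne_yx].
  case/IHs=> t1 [t2 [-> s1t1 s2t2]]; exists (x :: t1), t2.
  by split=> //=; rewrite eqxx.
case/(IHs (y :: s1)) => t1 [t2 [-> s1t1 s2t2]]; exists (x :: t1), t2; split=> //.
by rewrite /=; case: eqP.
Qed.

Lemma subseq_map_preim (S T : eqType) (f : S -> T) (x : seq T) (s : seq S) :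
  subseq x (map f s) -> exists2 y, subseq y s & x = map f y.
Proof.
case/subseqP=> m sz_m ->; exists (mask m s); first exact: mask_subseq.
by rewrite map_mask.
Qed.

Lemma nseq_subseq (T : eqType) (a : T) r s : r <= count_mem a s -> subseq (nseq r a) s.
Proof.
move=> le_r; have /all_pred1P := filter_all (pred1 a) s.
rewrite size_filter => def_a.
apply: subseq_trans (filter_subseq (pred1 a) s).
rewrite def_a -(subnKC le_r) nseqD; exact: prefix_subseq.
Qed.

Lemma subseq_sorted_sub (T : eqType) (e : rel T) (y s : seq T) :
  transitive e -> irreflexive e -> sorted e y -> sorted e s -> {subset y <= s} ->
  subseq y s.
Proof.
move=> e_tr e_irr ey es sub_ys.
rewrite (_ : y = [seq x <- s | x \in y]) ?filter_subseq //.
apply: (irr_sorted_eq e_tr e_irr) => //; first exact: sorted_filter.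
by move=> x; rewrite mem_filter; apply/esym/andb_idr/sub_ys.
Qed.

(** * Standardization *)

(** Counting the smaller letters of [x] preserves and reflects the order of the
    letters of [x]. *)
Lemma standardization_sorted_ltn x : sorted ltn (standardization x) = sorted ltn x.
Proof.
rewrite /standardization.
have mono a b : a \in x ->
    (count (fun y => y < a) x).+1 < (count (fun y => y < b) x).+1 = (a < b).
  rewrite ltnS; case: (ltnP a b) => [lt_ab|le_ba] xa.
    rewrite -!size_filter.
    have -> : [seq y <- x | y < a] = [seq y <- [seq y <- x | y < b] | y < a].
      by rewrite -filter_predI; apply: eq_filter => y /=; lia.
    rewrite [in X in _ < X](_ : size _ = count (fun y => y < a) [seq y <- x | y < b] +
      count (predC (fun y => y < a)) [seq y <- x | y < b]); last by rewrite count_predC.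
    rewrite size_filter -[X in X < _]addn0 ltn_add2l -has_count.
    by apply/hasP; exists a; rewrite ?mem_filter ?lt_ab //= ltnn.
  by apply/negbTE; rewrite -leqNgt; apply: sub_count => y /=; lia.
rewrite sorted_map; apply: (@eq_in_sorted _ (mem x)) => [a b xa _|]; last exact/allP.
exact: mono.
Qed.

Lemma standardization_sorted_gtn x : sorted gtn (standardization x) = sorted gtn x.
Proof.
have std_rev: standardization (rev x) = rev (standardization x).
  by rewrite /standardization map_rev; congr rev; apply: eq_map => y; rewrite count_rev.
have rev_gtn s : sorted gtn s = sorted ltn (rev s) by rewrite rev_sorted.
by rewrite !rev_gtn -std_rev standardization_sorted_ltn.
Qed.

Lemma size_standardization x : size (standardization x) = size x.
Proof. exact: size_map. Qed.

Lemma standardization_bounds x : {subset standardization x <= iota 1 (size x)}.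
Proof.
move=> _ /mapP[a xa ->]; rewrite mem_iota /= add1n ltnS.
rewrite ltn_neqAle count_size andbT -all_count.
by apply/negP => /allP/(_ a xa); rewrite ltnn.
Qed.

Lemma uniq_standardization_perm x : uniq (standardization x) ->
  perm_eq (standardization x) (iota 1 (size x)).
Proof.
move=> Ux; apply: uniq_perm => //; first exact: iota_uniq.
have [] := uniq_min_size Ux (@standardization_bounds x); last by [].
by rewrite size_iota size_standardization.
Qed.

Lemma gtn_trans : transitive gtn. Proof. by move=> a b c /=; lia. Qed.
Lemma gtn_irr : irreflexive gtn. Proof. by move=> a /=; lia. Qed.

Lemma standardization_iota k x :
  (standardization x == iota 1 k) = (size x == k) && sorted ltn x.
Proof.
apply/eqP/andP => [def_x | [/eqP<- ltx]].
  by rewrite -size_standardization -standardization_sorted_ltn def_x size_iota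
             iota_ltn_sorted.
rewrite -standardization_sorted_ltn in ltx.
apply: (irr_sorted_eq ltn_trans ltnn) => //; first exact: iota_ltn_sorted.
exact/perm_mem/uniq_standardization_perm/(sorted_uniq ltn_trans ltnn).
Qed.

Lemma standardization_rev_iota k x :
  (standardization x == rev (iota 1 k)) = (size x == k) && sorted gtn x.
Proof.
have gt_rev: sorted gtn (rev (iota 1 k)) by rewrite rev_sorted iota_ltn_sorted.
apply/eqP/andP => [def_x | [/eqP def_k gtx]].
  by rewrite -size_standardization -standardization_sorted_gtn def_x size_rev size_iota.
rewrite -standardization_sorted_gtn in gtx.
apply: (irr_sorted_eq gtn_trans gtn_irr) => // y; rewrite mem_rev -def_k.
exact/perm_mem/uniq_standardization_perm/(sorted_uniq gtn_trans gtn_irr).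
Qed.

Lemma standardization_id n u : perm_eq u (iota 1 n) -> standardization u = u.
Proof.
move=> pu; rewrite /standardization -[RHS]map_id; apply/eq_in_map => y uy.
rewrite (seq.permP pu); move: uy; rewrite (perm_mem pu) mem_iota => /andP[y1 yn].
have -> : n = y.-1 + (n - y.-1) by lia.
rewrite iotaD count_cat (eq_in_count (a2 := xpredT)) => [|z]; last first.
  by rewrite mem_iota /=; lia.
rewrite (@eq_in_count _ _ xpred0 (iota _ (_ - _))) => [|z]; last first.
  by rewrite mem_iota /=; lia.
by rewrite count_predT size_iota count_pred0 addn0 prednK.
Qed.

(** * A crystal operator on words *)

Section Crystal.

Variable a : nat.

(** The word is read as a lattice path on which [a] is an up step, [a + 1] a down
    step, and every other letter is flat; [height] is the maximum that the path
    reaches.  Truncated subtraction makes this recursion from the left correct: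
    a tail that never recovers from a down step contributes the maximum 0. *)
Fixpoint height (w : seq nat) : nat :=
  if w is x :: w' then
    if x == a then (height w').+1 else if x == a.+1 then (height w').-1 else height w'
  else 0.

(** The crystal operator: the up step that first reaches the maximum of the path
    becomes a down step. *)
Fixpoint lower (w : seq nat) : seq nat :=
  if w is x :: w' then
    if (x == a) && (height w' == 0) then a.+1 :: w' else x :: lower w'
  else [::].

(** The inverse of [lower]: the down step that leaves the maximum for the last
    time becomes an up step. *)
Fixpoint raise (w : seq nat) : seq nat :=
  if w is x :: w' then
    if (x == a.+1) && (height w' == 0) then a :: w' else x :: raise w'
  else [::].

Let ne_ab : (a == a.+1) = false. Proof. by lia. Qed.
Let ne_ba : (a.+1 == a) = false. Proof. by lia. Qed.

Lemma height_lower w : height (lower w) = (height w).-1.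
Proof.
elim: w => //= x w IHw; case: (eqVneq x a) => [->|xa] /=.
  case: eqP => [w0|w0] /=; first by rewrite ne_ba eqxx w0.
  by rewrite eqxx IHw; lia.
by rewrite IHw (negbTE xa); case: ifP.
Qed.

Lemma lowerK w : 0 < height w -> raise (lower w) = w.
Proof.
elim: w => //= x w IHw; case: (eqVneq x a) => [->|xa] /=.
  case: eqP => [w0|w0] _ /=; first by rewrite eqxx w0.
  by rewrite ne_ab /= IHw //; lia.
case: (eqVneq x a.+1) => [->|xb] /= w_gt0; last by rewrite IHw.
by rewrite height_lower ifF ?IHw //; lia.
Qed.

Lemma count_lower w x : 0 < height w ->
  count_mem x (lower w) + (a == x) = count_mem x w + (a.+1 == x).
Proof.
elim: w => //= y w IHw; case: (eqVneq y a) => [->|ya] /=; last first.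
  case: (eqVneq y a.+1) => [->|yb] /= w_gt0; move: IHw; lia.
case: eqP => [w0|w0] _ /=; first lia.
by move: IHw; lia.
Qed.

Lemma height_ge w : count_mem a w <= height w + count_mem a.+1 w.
Proof.
elim: w => //= x w IHw; case: (eqVneq x a) => [->|xa]; first by rewrite ne_ab; lia.
by case: (eqVneq x a.+1) => _; lia.
Qed.

Lemma prefix_height0 B1 B2 : height (B1 ++ B2) = 0 -> count_mem a B1 <= count_mem a.+1 B1.
Proof.
suff: count_mem a B1 <= height (B1 ++ B2) + count_mem a.+1 B1 by move=> le_B h0; rewrite h0 in le_B.
elim: B1 => //= x w IHw; case: (eqVneq x a) => [->|xa]; first by rewrite ne_ab; lia.
by case: (eqVneq x a.+1) => _; lia.
Qed.

(** The changed letter splits the word into [A] and [B].  As the first step to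
    reach the maximum, it is preceded by segments of [A] without net descent and
    followed by segments of [B] without net ascent.  Having this for all segments
    next to the changed letter is what allows local exchanges of letters in
    subsequences. *)
Lemma lowerP w : 0 < height w ->
  exists A B,
  [/\ w = A ++ a :: B, lower w = A ++ a.+1 :: B,
      forall B1 B2, B = B1 ++ B2 -> count_mem a B1 <= count_mem a.+1 B1
    & forall A1 A2, A = A1 ++ A2 -> count_mem a.+1 A2 <= count_mem a A2].
Proof.
move=> w_gt0.
suff [A [B [-> -> B0 A_suf _]]] : exists A B,
  [/\ w = A ++ a :: B, lower w = A ++ a.+1 :: B, height B = 0,
      forall A1 A2, A = A1 ++ A2 -> count_mem a.+1 A2 <= count_mem a A2
    & (count_mem a A).+1 = height w + count_mem a.+1 A].
  by exists A, B; split=> // B1 B2 def_B; apply: (@prefix_height0 _ B2); rewrite -def_B.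
elim: w w_gt0 => //= x w IHw; case: (eqVneq x a) => [->|xa] /=.
  case: eqP => [w0|w0] _ /=.
    exists [::], w; rewrite w0; split=> //.
    by case=> // -[].
  case: IHw => [|A [B [def_w def_lw B0 A_suf cA]]]; first lia.
  exists (a :: A), B; rewrite def_lw {1}def_w; split=> //=; last by rewrite ne_ab eqxx; lia.
  case=> [A2 /= <-|y A1 A2 [_]] /=; last exact: A_suf.
  by rewrite ne_ab eqxx; have := A_suf [::] A erefl; lia.
move=> w_gt0; case: IHw => [|A [B [def_w def_lw B0 A_suf cA]]].
  by move: w_gt0; case: ifP; lia.
exists (x :: A), B; rewrite def_lw {1}def_w; split=> //=; rewrite ?(negbTE xa).
  case=> [A2 /= <-|y A1 A2 [_]] /=; last exact: A_suf.
  rewrite (negbTE xa); have := A_suf [::] A erefl.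
  by move: w_gt0; case: eqP => _; lia.
by move: w_gt0; case: eqP => _; lia.
Qed.

End Crystal.

(** * Monotone subsequences under the crystal operator *)

Lemma subseq_cat_cons (T : eqType) (x A B : seq T) c : subseq x (A ++ c :: B) ->
  subseq x (A ++ B) \/ exists y1 y2, [/\ x = y1 ++ c :: y2, subseq y1 A & subseq y2 B].
Proof.
elim: A x => [|d A IHA] [|e x] /=.
- by left; apply: sub0seq.
- case: eqP => [->|_] x_s; last by left.
  by right; exists [::], x.
- by left.
case: eqP => [->|ne_ed] x_s.
  case/IHA: x_s => [x_s|[y1 [y2 [-> y1A y2B]]]]; first by left.
  by right; exists (d :: y1), y2; split=> //=; rewrite eqxx.
case/IHA: x_s => [x_s|[[|f y1] [y2 [-> y1A y2B]]]]; first by left.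
  by right; exists [::], y2.
right; exists (f :: y1), y2; split=> //.
by move: y1A => /=; case: eqP => // _; apply: subseq_trans (subseq_cons _ _).
Qed.

Lemma sorted_leq_cat_cons x c y : sorted leq (x ++ c :: y) =
  [&& sorted leq x, all (fun z => z <= c) x, all (fun z => c <= z) y & sorted leq y].
Proof.
rewrite !sorted_pairwise; try exact: leq_trans.
rewrite pairwise_cat /= allrel_consr; apply/idP/idP.
  by case/and3P=> /andP[-> _] -> /andP[-> ->].
case/and4P=> -> x_c c_y ->; rewrite x_c c_y /= !andbT.
by apply/allrelP => u v /(allP x_c) uc /(allP c_y); apply: leq_trans.
Qed.

Lemma sorted_gtn_cat_cons x c y : sorted gtn (x ++ c :: y) =
  [&& sorted gtn x, all (fun z => c < z) x, all (fun z => z < c) y & sorted gtn y].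
Proof.
have tr : transitive gtn by move=> ? ? ? /=; lia.
rewrite !sorted_pairwise //.
rewrite pairwise_cat /= allrel_consr; apply/idP/idP.
  by case/and3P=> /andP[-> _] -> /andP[-> ->].
case/and4P=> -> x_c c_y ->; rewrite x_c c_y /= !andbT.
by apply/allrelP => u v /(allP x_c) uc /(allP c_y) /=; lia.
Qed.

Lemma sorted_leq_cut c x : sorted leq x ->
  x = [seq z <- x | z < c] ++ [seq z <- x | c <= z].
Proof.
elim: x => //= z x IHx zx; case: (ltnP z c) => [lt_zc|le_cz] /=.
  by rewrite -IHx ?(path_sorted zx).
have /allP z_min := order_path_min leq_trans zx.
have -> : [seq y <- x | y < c] = [::].
  apply/eqP; rewrite -[_ == _]negbK -has_filter; apply/hasPn => y /z_min.
  by rewrite -leqNgt; apply: leq_trans.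
by rewrite (_ : [seq y <- x | c <= y] = x) //; apply/all_filterP/allP => y /z_min; apply: leq_trans.
Qed.

Lemma sorted_leq_cat_sep c x y :
  sorted leq x -> sorted leq y -> all (fun z => z <= c) x -> all (fun z => c <= z) y ->
  sorted leq (x ++ y).
Proof.
rewrite !(sorted_pairwise leq_trans) pairwise_cat => -> -> /allP x_c /allP c_y.
by rewrite !andbT; apply/allrelP => u v /x_c uc /c_y; apply: leq_trans.
Qed.

Lemma sorted_leq_nseq r c : sorted leq (nseq r c).
Proof. by elim: r => // -[|r] //= ->; rewrite leqnn. Qed.

(** In the next four lemmas a monotone subsequence that uses the changed letter is
    rebuilt with the same length from the other word.  A weakly increasing one
    uses, next to that letter, a run of letters [a] from the front of [B], or of
    letters [a + 1] from the end of [A]; balance supplies as many copies of the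
    other letter there.  A strictly decreasing one uses at most one [a] and one
    [a + 1]; if it uses both, balance finds this pair inside [A] or inside [B]
    alone. *)
Section LowerChains.

Variables (a : nat) (A B : seq nat).
Hypothesis B_prefix : forall B1 B2, B = B1 ++ B2 -> count_mem a B1 <= count_mem a.+1 B1.
Hypothesis A_suffix : forall A1 A2, A = A1 ++ A2 -> count_mem a.+1 A2 <= count_mem a A2.

Lemma leq_chain_lower x : subseq x (A ++ a :: B) -> sorted leq x ->
  exists y, [/\ subseq y (A ++ a.+1 :: B), size y = size x & sorted leq y].
Proof.
case/subseq_cat_cons=> [x_s lex|[y1 [y2 [-> y1A y2B]]]].
  by exists x; split=> //; apply: subseq_trans x_s _; apply/cat_subseq/subseq_cons.
rewrite sorted_leq_cat_cons => /and4P[le1 y1_a a_y2 le2].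
have def_y2 := sorted_leq_cut a.+1 le2.
set u := [seq z <- y2 | z <= a] in def_y2; set v := [seq z <- y2 | a < z] in def_y2.
have def_u : u = nseq (size u) a.
  apply/all_pred1P/allP => z; rewrite mem_filter /= => /andP[z_a /(allP a_y2)]; lia.
rewrite def_y2 in y2B; have [B1 [B2 [def_B uB1 vB2]]] := subseq_cat_split y2B.
have szu: size u <= count_mem a B1.
  have := leq_count_subseq (pred1 a) uB1.
  by rewrite [in count_mem _ u]def_u count_nseq /= eqxx mul1n.
exists (y1 ++ a.+1 :: nseq (size u) a.+1 ++ v); split.
- rewrite cat_subseq //= eqxx def_B cat_subseq // nseq_subseq //.
  exact: leq_trans szu (B_prefix def_B).
- by rewrite [in RHS]def_y2 !(size_cat, size_nseq) /= !(size_cat, size_nseq).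
rewrite sorted_leq_cat_cons le1 /=; apply/and3P; split.
- by apply/allP => z /(allP y1_a) /=; lia.
- rewrite all_cat all_nseq leqnn orbT /=.
  by apply/allP => z; rewrite mem_filter => /andP[].
apply: (@sorted_leq_cat_sep a.+1); rewrite ?sorted_leq_nseq ?all_nseq ?leqnn ?orbT //.
  exact: (sorted_filter leq_trans).
by apply/allP => z; rewrite mem_filter => /andP[].
Qed.

Lemma leq_chain_raise x : subseq x (A ++ a.+1 :: B) -> sorted leq x ->
  exists y, [/\ subseq y (A ++ a :: B), size y = size x & sorted leq y].
Proof.
case/subseq_cat_cons=> [x_s lex|[y1 [y2 [-> y1A y2B]]]].
  by exists x; split=> //; apply: subseq_trans x_s _; apply/cat_subseq/subseq_cons.
rewrite sorted_leq_cat_cons => /and4P[le1 y1_a a_y2 le2].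
have def_y1 := sorted_leq_cut a.+1 le1.
set v := [seq z <- y1 | z <= a] in def_y1; set u := [seq z <- y1 | a < z] in def_y1.
have def_u : u = nseq (size u) a.+1.
  by apply/all_pred1P/allP => z; rewrite mem_filter /= => /andP[z_a /(allP y1_a)]; lia.
rewrite def_y1 in y1A; have [A1 [A2 [def_A vA1 uA2]]] := subseq_cat_split y1A.
have szu: size u <= count_mem a.+1 A2.
  have := leq_count_subseq (pred1 a.+1) uA2.
  by rewrite [in count_mem _ u]def_u count_nseq /= eqxx mul1n.
exists ((v ++ nseq (size u) a) ++ a :: y2); split.
- rewrite cat_subseq //= ?eqxx // def_A cat_subseq // nseq_subseq //.
  exact: leq_trans szu (A_suffix def_A).
- by rewrite [in RHS]def_y1 !(size_cat, size_nseq).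
rewrite sorted_leq_cat_cons le2 andbT; apply/and3P; split.
- apply: (@sorted_leq_cat_sep a); rewrite ?sorted_leq_nseq ?all_nseq ?leqnn ?orbT //.
    exact: (sorted_filter leq_trans).
  by apply/allP => z; rewrite mem_filter => /andP[].
- rewrite all_cat all_nseq leqnn orbT andbT.
  by apply/allP => z; rewrite mem_filter => /andP[].
- by apply/allP => z /(allP a_y2) /=; lia.
Qed.

Lemma gtn_chain_lower x : subseq x (A ++ a :: B) -> sorted gtn x ->
  exists y, [/\ subseq y (A ++ a.+1 :: B), size y = size x & sorted gtn y].
Proof.
case/subseq_cat_cons=> [x_s gtx|[y1 [y2 [-> y1A y2B]]] gtx].
  by exists x; split=> //; apply: subseq_trans x_s _; apply/cat_subseq/subseq_cons.
move: (gtx); rewrite sorted_gtn_cat_cons => /and4P[gt1 y1_a a_y2 gt2].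
have [a1_y1|a1_y1] := boolP (a.+1 \in y1); last first.
  exists (y1 ++ a.+1 :: y2); rewrite cat_subseq //= ?eqxx // !size_cat; split=> //.
  rewrite sorted_gtn_cat_cons gt1 gt2 andbT /=; apply/andP; split.
    apply/allP => z z_y1; have := allP y1_a _ z_y1; rewrite leq_eqVlt.
    by case: eqP z_y1 => [<- /(negP a1_y1)|].
  by apply/allP => z /(allP a_y2) /=; lia.
exists (y1 ++ a :: y2); split=> //.
have [t def_y1] : exists t, y1 = t ++ [:: a.+1].
  case/splitPr: a1_y1 y1_a gt1 => p1 p2; rewrite all_cat /= => /and3P[_ _ p2_a].
  rewrite sorted_gtn_cat_cons => /and4P[_ _ p2_a1 _].
  case: p2 p2_a p2_a1 => [|z p2] /=; first by exists p1.
  by move=> /andP[z_gt _] /andP[z_lt _]; lia.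
rewrite def_y1 in y1A *; have [A1 [A2 [def_A tA1 a1A2]]] := subseq_cat_split y1A.
have [C1 [C2 [def_A2 _ aC2]]] : exists C1 C2,
    [/\ A2 = C1 ++ C2, True & subseq [:: a.+1; a] C2].
  move: a1A2; rewrite sub1seq => /splitPr def_A2; case: def_A2 def_A => p1 p2 def_A.
  exists p1, (a.+1 :: p2); split=> //=; rewrite eqxx sub1seq -has_pred1 has_count.
  by have := A_suffix (etrans def_A (catA _ _ _)); rewrite /= eqxx gtn_eqF //; lia.
rewrite -!catA /= def_A -catA cat_subseq // def_A2 -[_ :: _ :: y2]/([:: a.+1; a] ++ y2).
rewrite cat_subseq //; last exact: subseq_trans (subseq_cons _ _).
exact: subseq_trans aC2 (suffix_subseq _ _).
Qed.

Lemma gtn_chain_raise x : subseq x (A ++ a.+1 :: B) -> sorted gtn x ->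
  exists y, [/\ subseq y (A ++ a :: B), size y = size x & sorted gtn y].
Proof.
case/subseq_cat_cons=> [x_s gtx|[y1 [y2 [-> y1A y2B]]] gtx].
  by exists x; split=> //; apply: subseq_trans x_s _; apply/cat_subseq/subseq_cons.
move: (gtx); rewrite sorted_gtn_cat_cons => /and4P[gt1 y1_a a_y2 gt2].
have [a_y2'|a_y2'] := boolP (a \in y2); last first.
  exists (y1 ++ a :: y2); rewrite cat_subseq //= ?eqxx // !size_cat; split=> //.
  rewrite sorted_gtn_cat_cons gt1 gt2 andbT /=; apply/andP; split.
    by apply/allP => z /(allP y1_a) /=; lia.
  apply/allP => z z_y2; have := allP a_y2 _ z_y2; rewrite ltnS leq_eqVlt.
  by case: eqP z_y2 => [-> /(negP a_y2')|].
exists (y1 ++ a.+1 :: y2); split=> //; apply: cat_subseq => //.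
have [t def_y2] : exists t, y2 = a :: t.
  case/splitPr: a_y2' a_y2 gt2 => p1 p2; rewrite all_cat => /andP[p1_a _].
  rewrite sorted_gtn_cat_cons => /and4P[_ a_p1 _ _].
  case: p1 p1_a a_p1 => [|z p1] /=; first by exists p2.
  by move=> /andP[z_gt _] /andP[z_lt _]; lia.
rewrite def_y2 in y2B *.
have [B1 [B2 [def_B aB1 tB2]]] := @subseq_cat_split _ [:: a] t B y2B.
have [C1 [C2 [def_B1 a1C1 aC2]]] : exists C1 C2,
    [/\ B1 = C1 ++ C2, subseq [:: a.+1] C1 & subseq [:: a] C2].
  move: aB1; rewrite sub1seq => /splitPr def_B1; case: def_B1 def_B => p1 p2 def_B.
  exists p1, (a :: p2); split=> //=; rewrite ?eqxx ?sub0seq // sub1seq -has_pred1 has_count.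
  have := @B_prefix (rcons p1 a) (p2 ++ B2); rewrite cat_rcons def_B -catA => /(_ erefl).
  by rewrite -!cats1 !count_cat /= eqxx ltn_eqF //; lia.
apply: subseq_trans (subseq_cons _ _).
rewrite def_B def_B1 -catA -[_ :: _ :: t]/([:: a.+1] ++ [:: a] ++ t).
by rewrite !cat_subseq.
Qed.

End LowerChains.

(** * Counting rearrangements up to renaming of letters *)

Section IterLower.

Variable a : nat.

Lemma height_iter_lower j w : height a (iter j (lower a) w) = height a w - j.
Proof. by elim: j => [|j IHj] /=; rewrite ?subn0 // height_lower IHj subnS. Qed.

Lemma iter_lowerK j w : j <= height a w -> iter j (raise a) (iter j (lower a) w) = w.
Proof.
elim: j => // j IHj lt_j; rewrite iterSr [iter j.+1 (lower a) w]iterS lowerK.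
  by rewrite IHj // ltnW.
by rewrite height_iter_lower subn_gt0.
Qed.

Lemma count_iter_lower j w x : j <= height a w ->
  count_mem x (iter j (lower a) w) + j * (a == x) = count_mem x w + j * (a.+1 == x).
Proof.
elim: j => // j IHj lt_j; have := IHj (ltnW lt_j).
have := @count_lower a (iter j (lower a) w) x.
by rewrite height_iter_lower subn_gt0 => /(_ lt_j) /=; rewrite !mulSn; lia.
Qed.

End IterLower.

Definition has_chain k w :=
  has (fun x => (size x == k) && (sorted leq x || sorted gtn x)) (subseqs w).

Lemma has_chainP k w :
  reflect (exists x, [/\ subseq x w, size x = k & sorted leq x \/ sorted gtn x])
          (has_chain k w).
Proof.
apply: (iffP hasP) => [[x]|[x [x_w <- x_s]]].
  by rewrite mem_subseqs => x_w /andP[/eqP<- /orP x_s]; exists x.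
by exists x; rewrite ?mem_subseqs ?eqxx //; apply/orP.
Qed.

(** Words with such a property can be counted up to renaming of letters.  The
    instances of interest are the absence of long monotone subsequences and the
    predicate [xpredT], which counts all rearrangements. *)
Definition crystal_invariant (P : pred (seq nat)) :=
  forall a w, 0 < height a w -> P (lower a w) = P w.

Lemma has_chain_crystal_invariant k : crystal_invariant (has_chain k).
Proof.
move=> a w /lowerP[A [B [-> -> B_pre A_suf]]].
apply/has_chainP/has_chainP => -[x [x_w <- [] x_s]].
- have [y [y_w sz_y y_s]] := leq_chain_raise A_suf x_w x_s.
  by exists y; split=> //; left.
- have [y [y_w sz_y y_s]] := gtn_chain_raise B_pre x_w x_s.
  by exists y; split=> //; right.
- have [y [y_w sz_y y_s]] := leq_chain_lower B_pre x_w x_s.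
  by exists y; split=> //; left.
- have [y [y_w sz_y y_s]] := gtn_chain_lower A_suf x_w x_s.
  by exists y; split=> //; right.
Qed.

Lemma iter_lower_invariant P a j w : crystal_invariant P -> j <= height a w ->
  P (iter j (lower a) w) = P w.
Proof.
move=> P_inv; elim: j => //= j IHj lt_j.
by rewrite P_inv ?IHj ?(ltnW lt_j) // height_iter_lower subn_gt0.
Qed.

Definition swap (x y z : nat) := if z == x then y else if z == y then x else z.

Lemma swapK x y : involutive (swap x y).
Proof.
move=> z; rewrite /swap; case: (z =P x) => [->|/eqP/negbTE zx].
  by case: (y =P x) => [->|_]; rewrite ?eqxx.
by case: (z =P y) => [->|/eqP/negbTE zy]; rewrite ?eqxx // zx zy.
Qed.

Lemma swap_inj x y : injective (swap x y). Proof. exact: inv_inj (swapK x y). Qed.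

Lemma swapL x y : swap x y x = y. Proof. by rewrite /swap eqxx. Qed.

Lemma swapR x y : swap x y y = x.
Proof. by rewrite -{2}(swapL x y) swapK. Qed.

Lemma swapD x y z : z != x -> z != y -> swap x y z = z.
Proof. by rewrite /swap => /negbTE-> /negbTE->. Qed.

Lemma count_map_swap x y z s :
  count_mem z (map (swap x y) s) = count_mem (swap x y z) s.
Proof.
by rewrite count_map; apply: eq_count => u /=; rewrite (inv_eq (swapK x y)).
Qed.

Lemma size_permutations_swap x y t :
  size (permutations (map (swap x y) t)) = size (permutations t).
Proof.
have le s : size (permutations s) <= size (permutations (map (swap x y) s)).
  rewrite -(size_map (map (swap x y))); apply: uniq_leq_size.
    by rewrite map_inj_uniq ?permutations_uniq //; apply/inj_map/swap_inj.
  move=> _ /mapP[u + ->]; rewrite !mem_permutations; exact: perm_map.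
by apply/eqP; rewrite eqn_leq le andbT -{2}(mapK (swapK x y) t) le.
Qed.

Definition word_count (P : pred (seq nat)) t := count P (permutations t).

(** The iterate is defined since a path ending at height [j] reaches height [j];
    it is injective by [iter_lowerK].  It is onto because both sides have equally
    many elements. *)
Lemma perm_iter_lower a t : count_mem a.+1 t <= count_mem a t ->
  perm_eq [seq iter (count_mem a t - count_mem a.+1 t) (lower a) w | w <- permutations t]
          (permutations (map (swap a a.+1) t)).
Proof.
set j := _ - _ => le_t.
have le_j w : w \in permutations t -> j <= height a w.
  rewrite mem_permutations => /seq.permP pw; have := height_ge a w.
  by rewrite !pw /j; lia.
have U : uniq [seq iter j (lower a) w | w <- permutations t].
  rewrite map_inj_in_uniq ?permutations_uniq // => u v /le_j ju /le_j jv eq_uv.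
  by rewrite -(iter_lowerK ju) eq_uv iter_lowerK.
have sub: {subset [seq iter j (lower a) w | w <- permutations t]
             <= permutations (map (swap a a.+1) t)}.
  move=> _ /mapP[w tw ->]; have := le_j w tw; rewrite !mem_permutations in tw * => jw.
  apply/allP => x _ /=; rewrite count_map_swap; apply/eqP.
  have := count_iter_lower x jw; rewrite !(seq.permP tw) /swap.
  case: (eqVneq x a) => [->|xa]; first rewrite gtn_eqF // muln0 muln1 addn0 => def_a.
    by apply/eqP; rewrite -(eqn_add2r j) def_a /j subnKC.
  case: (eqVneq x a.+1) => [->|xa1]; first rewrite muln0 muln1 addn0 => ->.
    by rewrite /j subnKC.
  by rewrite !muln0 !addn0.
apply: uniq_perm; rewrite ?permutations_uniq //.
by have [] := uniq_min_size U sub; rewrite ?size_map ?size_permutations_swap.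
Qed.

(** [perm_iter_lower] provides a bijection between the two sets of rearrangements,
    and every step of it preserves [P]. *)
Lemma word_count_swap_adjacent P a t : crystal_invariant P ->
  word_count P (map (swap a a.+1) t) = word_count P t.
Proof.
move=> P_inv; wlog le_t : t / count_mem a.+1 t <= count_mem a t => [wlogH|].
  have [|lt_t] := leqP (count_mem a.+1 t) (count_mem a t); first exact: wlogH.
  rewrite -{2}(mapK (swapK a a.+1) t) [in RHS]wlogH // !count_map_swap /swap.
  by rewrite !eqxx gtn_eqF // ltnW.
rewrite /word_count -(seq.permP (perm_iter_lower le_t)) count_map.
apply: eq_in_count => w; rewrite mem_permutations => /seq.permP pw /=.
by rewrite iter_lower_invariant // leq_subLR addnC -!pw height_ge.
Qed.

(** A transposition of distant letters is a conjugate of a shorter one by a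
    transposition of neighbours. *)
Lemma word_count_swap P x y t : crystal_invariant P ->
  word_count P (map (swap x y) t) = word_count P t.
Proof.
move=> P_inv.
have up d u s : word_count P (map (swap u (u + d)) s) = word_count P s.
  elim: d u s => [|d IHd] u s.
    rewrite addn0 (eq_map (g := id)) ?map_id // => z.
    by rewrite /swap; case: eqVneq.
  case: d IHd => [|d] IHd; first by rewrite addn1 word_count_swap_adjacent.
  have conj : swap u (u + d.+2) =1 swap u u.+1 \o swap u.+1 (u.+1 + d.+1) \o swap u u.+1.
    move=> z /=; rewrite addSnnS.
    have [->|zu] := eqVneq z u; first by rewrite !swapL swapD //; lia.
    have [->|zu1] := eqVneq z u.+1.
      by rewrite swapR (@swapD u.+1 _ u) ?swapL ?swapD //; lia.
    have [->|zv] := eqVneq z (u + d.+2).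
      by rewrite swapR (@swapD u u.+1 (u + d.+2)) ?swapR //; lia.
    by rewrite !swapD.
  by rewrite (eq_map conj) !map_comp word_count_swap_adjacent // IHd word_count_swap_adjacent.
have [le_xy|/ltnW le_yx] := leqP x y; first by rewrite -(subnKC le_xy) up.
rewrite (eq_map (g := swap y x)) => [|z]; first by rewrite -(subnKC le_yx) up.
by rewrite /swap; case: eqVneq => [->|]; case: eqVneq.
Qed.

(** On the finitely many letters of [t], an injection agrees with a product of
    transpositions. *)
Lemma word_count_rename P (f : nat -> nat) t : crystal_invariant P -> injective f ->
  word_count P (map f t) = word_count P t.
Proof.
move=> P_inv f_inj.
suff [g [g_inj gP eq_fg]] : exists g, [/\ injective g,
    forall s, word_count P (map g s) = word_count P s & {in t, f =1 g}].
  by have -> : map f t = map g t by [apply/eq_in_map]; rewrite gP.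
elim: t => [|x t [g [g_inj gP eq_fg]]]; first by exists id; split=> // s; rewrite map_id.
have [xt|xt] := boolP (x \in t).
  by exists g; split=> // y; rewrite inE => /predU1P[->|]; apply: eq_fg.
exists (swap (g x) (f x) \o g); split.
- exact/inj_comp/g_inj/swap_inj.
- by move=> s; rewrite map_comp word_count_swap.
move=> y; rewrite inE => /predU1P[->|yt] /=; first by rewrite swapL.
have ne_yx: y != x by apply: contraNneq xt => <-.
rewrite -(eq_fg y yt) swapD ?(inj_eq f_inj) //.
by rewrite (eq_fg y yt) (inj_eq g_inj).
Qed.

(** * Permutations as sorted biwords *)

Definition lex (p q : nat * nat) := (p.1 < q.1) || (p.1 == q.1) && (p.2 <= q.2).

Lemma lex_total : total lex.
Proof. by move=> [a i] [b j]; rewrite /lex /=; lia. Qed.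

Lemma lex_trans : transitive lex.
Proof. by move=> [a i] [b j] [c k]; rewrite /lex /=; lia. Qed.

Lemma lex_anti : antisymmetric lex.
Proof. by move=> [a i] [b j]; rewrite /lex /= => H; congr pair; lia. Qed.

(** For a permutation [u] this says that descents of [u] only occur at strict
    increases of the sorted word ([compatible_Des]).  Written as sortedness of a
    biword, it becomes amenable to uniqueness of sorted sequences. *)
Definition compatible (t u : seq nat) := sorted lex (zip (sort leq t) u).

Definition biword (w : seq nat) := zip w (iota 1 (size w)).

(** The inverse of the standardization of [w], in one-line notation. *)
Definition inv_std (w : seq nat) := unzip2 (sort lex (biword w)).

Lemma unzip1_biword w : unzip1 (biword w) = w.
Proof. by rewrite unzip1_zip ?size_iota. Qed.

Lemma unzip2_biword w : unzip2 (biword w) = iota 1 (size w).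
Proof. by rewrite unzip2_zip ?size_iota. Qed.

Lemma sorted_biword w : sorted (relpre snd ltn) (biword w).
Proof. by rewrite -sorted_map -/(unzip2 _) unzip2_biword iota_ltn_sorted. Qed.

Lemma unzip1_sorted_lex s : sorted lex s -> sorted leq (unzip1 s).
Proof. by rewrite sorted_map; apply: sub_sorted => -[a i] [b j]; rewrite /lex /=; lia. Qed.

Lemma snd_ltn_trans : transitive (relpre (@snd nat nat) ltn).
Proof. by move=> a b c /=; apply: ltn_trans. Qed.

Lemma snd_ltn_irr : irreflexive (relpre (@snd nat nat) ltn).
Proof. by move=> a /=; apply: ltnn. Qed.

Lemma sort_biword t w : perm_eq w t -> sort lex (biword w) = zip (sort leq t) (inv_std w).
Proof.
move=> pw; rewrite -[LHS]zip_unzip -/(inv_std w); congr zip.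
apply: (sorted_eq leq_trans anti_leq); rewrite ?sort_sorted //; try exact: leq_total.
  exact/unzip1_sorted_lex/sort_sorted/lex_total.
rewrite perm_sym perm_sort perm_sym; apply: perm_trans pw.
by rewrite -[X in perm_eq _ X]unzip1_biword perm_map // perm_sort.
Qed.

(** The biword of [w] is recovered from [inv_std w]: its sorted form has top row
    [sort leq t] and bottom row [inv_std w], and resorting by the bottom row
    restores the order of positions. *)
Lemma perm_inv_std t :
  perm_eq [seq inv_std w | w <- permutations t]
          [seq u <- permutations (iota 1 (size t)) | compatible t u].
Proof.
apply: uniq_perm; rewrite ?filter_uniq ?permutations_uniq //.
  rewrite map_inj_in_uniq ?permutations_uniq // => w w'.
  rewrite !mem_permutations => pw pw' eq_ww'.
  have eq_s : sort lex (biword w) = sort lex (biword w').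
    by rewrite (sort_biword pw) (sort_biword pw') eq_ww'.
  rewrite -(unzip1_biword w) -(unzip1_biword w'); congr unzip1.
  apply: (irr_sorted_eq snd_ltn_trans snd_ltn_irr); rewrite ?sorted_biword //.
  by move=> p; rewrite -(mem_sort lex) eq_s mem_sort.
move=> u; rewrite mem_filter mem_permutations; apply/mapP/andP => [[w + ->]|[cu pu]].
  rewrite mem_permutations => pw; split.
    by rewrite /compatible -(sort_biword pw); apply/sort_sorted/lex_total.
  by rewrite -(perm_size pw) -unzip2_biword perm_map // perm_sort.
have sz_u : size u = size (sort leq t) by rewrite (perm_size pu) size_iota size_sort.
pose Y := zip (sort leq t) u; pose Z := sort (relpre snd leq) Y.
have pZ: perm_eq Z Y by rewrite perm_sort.
have pw: perm_eq (unzip1 Z) t.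
  apply: perm_trans (perm_map _ pZ) _.
  by rewrite -/(unzip1 _) unzip1_zip ?sz_u // perm_sort.
have def_Z : biword (unzip1 Z) = Z.
  rewrite -[RHS]zip_unzip /biword (perm_size pw); congr zip; apply/esym.
  apply: (sorted_eq leq_trans anti_leq); rewrite ?iota_sorted //.
    by rewrite sorted_map; apply: sort_sorted => p q /=; apply: leq_total.
  by apply: perm_trans (perm_map _ pZ) _; rewrite -/(unzip2 _) unzip2_zip ?sz_u.
exists (unzip1 Z); first by rewrite mem_permutations.
rewrite /inv_std def_Z (_ : sort lex Z = Y) ?unzip2_zip ?sz_u //.
apply: (sorted_eq lex_trans lex_anti) => //; last by rewrite perm_sort.
exact/sort_sorted/lex_total.
Qed.

Definition has_strict_chain k u :=
  has (fun x => (size x == k) && (sorted ltn x || sorted gtn x)) (subseqs u).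

Lemma subseq_biword w y :
  sorted (relpre snd ltn) y -> {subset y <= biword w} -> subseq y (biword w).
Proof.
move=> y_s; apply: subseq_sorted_sub (sorted_biword w) => //.
  exact: snd_ltn_trans.
exact: snd_ltn_irr.
Qed.

Lemma subseq_sort_biword w y y0 : subseq y0 (biword w) -> perm_eq y y0 ->
  sorted lex y -> subseq y (sort lex (biword w)).
Proof.
move=> y0_w pyy0 y_s; suff -> : y = sort lex y0 by apply: (subseq_sort lex_total lex_trans).
apply: (sorted_eq lex_trans lex_anti) => //; first exact/sort_sorted/lex_total.
by rewrite perm_sym perm_sort perm_sym.
Qed.

Lemma sorted_combine (T : Type) (e1 e2 e : rel T) s :
  (forall x y, e1 x y -> e2 x y -> e x y) -> sorted e1 s -> sorted e2 s -> sorted e s.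
Proof.
move=> sub s1 s2; have : sorted [rel x y | e1 x y && e2 x y] s by rewrite sorted_relI s1.
by apply: sub_sorted => x y /andP[]; apply: sub.
Qed.

(** Columns of the biword listed with increasing positions form a subsequence of
    [w]; listed in lexicographic order they form a subsequence of [inv_std w].
    For a weakly increasing choice of letters both orders agree, and for a
    strictly decreasing one they are opposite.  Ties between letters are broken by
    increasing positions, whence weak increase against strict decrease. *)
Lemma has_strict_chain_inv_std k w : has_strict_chain k (inv_std w) = has_chain k w.
Proof.
apply/hasP/has_chainP => [[x + /andP[/eqP sz_x x_s]]|[x [x_w sz_x x_s]]].
  rewrite mem_subseqs => /subseq_map_preim[y y_w def_x].
  have y_lex : sorted lex y.
    apply: (subseq_sorted lex_trans y_w); exact: (sort_sorted lex_total).
  have sub_y : {subset y <= biword w} by move=> p /(mem_subseq y_w); rewrite mem_sort.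
  case/orP: x_s; rewrite def_x sorted_map => y_s.
    exists (unzip1 y); split; last by left; apply: unzip1_sorted_lex.
      by rewrite -(unzip1_biword w) map_subseq // subseq_biword.
    by rewrite -sz_x def_x !size_map.
  exists (rev (unzip1 y)); split; last right.
  - rewrite -(unzip1_biword w) -map_rev map_subseq // subseq_biword ?rev_sorted //.
    by move=> p; rewrite mem_rev => /sub_y.
  - by rewrite -sz_x def_x size_rev !size_map.
  rewrite rev_sorted sorted_map; apply: sorted_combine y_lex y_s => -[a i] [b j].
  by rewrite /lex /=; lia.
rewrite -(unzip1_biword w) in x_w; have [y y_w def_x] := subseq_map_preim x_w.
have y_snd := subseq_sorted snd_ltn_trans y_w (sorted_biword w).
case: x_s; rewrite def_x sorted_map => y_s.
  exists (unzip2 y); last by rewrite -sz_x def_x !size_map eqxx sorted_map y_snd.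
  rewrite mem_subseqs map_subseq // (@subseq_sort_biword w y y) //.
  by apply: sorted_combine y_s y_snd => -[a i] [b j]; rewrite /lex /=; lia.
exists (unzip2 (rev y)); last first.
  rewrite size_map size_rev -sz_x def_x size_map eqxx /=; apply/orP; right.
  by rewrite /unzip2 map_rev rev_sorted sorted_map.
rewrite mem_subseqs map_subseq // (@subseq_sort_biword w (rev y) y) ?perm_rev //.
by rewrite rev_sorted; apply: sub_sorted y_s => -[a i] [b j]; rewrite /lex /=; lia.
Qed.

(** * Coefficients of the pattern quasisymmetric functions *)

Lemma size_oneline n (s : 'S_n) : size (oneline s) = n.
Proof. by rewrite size_map size_enum_ord. Qed.

Lemma nth_oneline n (s : 'S_n) (i : 'I_n) : nth 0 (oneline s) i = (s i).+1.
Proof. by rewrite (nth_map i) ?size_enum_ord // nth_ord_enum. Qed.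

Lemma oneline_inj n : injective (@oneline n).
Proof.
move=> s s' eq_ss'; apply/permP => i; apply/val_inj/succn_inj.
by rewrite -!nth_oneline eq_ss'.
Qed.

Lemma oneline_perm n (s : 'S_n) : perm_eq (oneline s) (iota 1 n).
Proof.
have U : uniq (oneline s).
  rewrite map_inj_uniq ?enum_uniq // => i j [] /val_inj; exact: perm_inj.
apply: uniq_perm; rewrite ?iota_uniq //.
have sub : {subset oneline s <= iota 1 n}.
  by move=> _ /mapP[i _ ->]; rewrite mem_iota /= add1n ltnS.
by have [] := uniq_min_size U sub; rewrite ?size_oneline ?size_iota.
Qed.

Lemma perm_oneline_enum n :
  perm_eq [seq oneline s | s : 'S_n] (permutations (iota 1 n)).
Proof.
have U : uniq [seq oneline s | s : 'S_n].
  by rewrite map_inj_uniq ?enum_uniq //; apply: oneline_inj.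
apply: uniq_perm; rewrite ?permutations_uniq //.
have sub : {subset [seq oneline s | s : 'S_n] <= permutations (iota 1 n)}.
  by move=> _ /mapP[s _ ->]; rewrite mem_permutations oneline_perm.
have [] := uniq_min_size U sub; last by [].
by rewrite size_permutations ?iota_uniq // size_iota size_map -cardE card_Sn.
Qed.

Definition has_pattern (p u : seq nat) :=
  has (fun x => standardization x == p) (subseqs u).

Lemma contains_has_pattern n k (s : 'S_n) (p : 'S_k) :
  contains s p = has_pattern (oneline p) (oneline s).
Proof.
apply/existsP/hasP => [[m std_m]|[x]].
  by exists (mask m (oneline s)); rewrite // mem_subseqs mask_subseq.
rewrite mem_subseqs => /subseqP[m sz_m ->] std_m.
have sz_m' : size m == n by rewrite sz_m size_oneline.
by exists (Tuple sz_m').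
Qed.

Definition avoids k (Pi : {set 'S_k}) (u : seq nat) :=
  [forall p in Pi, ~~ has_pattern (oneline p) u].

Definition coef n k (Pi : {set 'S_k}) (t : seq nat) :=
  count (fun u => compatible t u && avoids Pi u) (permutations (iota 1 n)).

Lemma compatible_Des n (s : 'S_n) t : size t = n ->
  compatible t (oneline s) =
  [forall j in Des s, nth 0 (sort leq t) j < nth 0 (sort leq t) j.+1].
Proof.
move=> sz_t; set v := sort leq t; set u := oneline s.
have sz_v : size v = n by rewrite size_sort.
have sz_u : size u = n by rewrite size_oneline.
have /(sortedP 0) v_s : sorted leq v by apply/sort_sorted/leq_total.
have sz_vu : size v = size u by rewrite sz_v.
apply/(sortedP (0, 0))/forall_inP; rewrite size_zip sz_vu minnn sz_u.
  move=> vu_s j; rewrite inE -/u => lt_u;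
  have lt_jn : j.+1 < n by have := ltn_ord j; lia.
  have := vu_s j lt_jn; rewrite !nth_zip // /lex /= => /orP[//|/andP[_]].
  by rewrite leqNgt lt_u.
move=> vu_s i lt_in; rewrite !nth_zip // /lex /=.
have lt_in' : i < n.-1 by lia.
have := vu_s (Ordinal lt_in'); rewrite inE -/u /=.
have := v_s i; rewrite sz_v lt_in => /(_ isT).
case: (ltnP (nth 0 u i.+1) (nth 0 u i)) => [_ _ /(_ isT) -> //|_ + _].
  by rewrite andbT orbC -leq_eqVlt.
Qed.

Section Coefficients.

Local Open Scope ring_scope.
Local Open Scope mset_scope.
Local Open Scope classical_set_scope.

(** Only the sorted arrangement of the monomial can occur among the index
    sequences of [F]. *)
Lemma F_coef (R : realType) n (s : 'S_n) (m : {mset nat}) :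
  F R (Des s) m = ((size m == n) && compatible m (oneline s))%:R.
Proof.
have only (t : n.-tuple nat) : sorted leq t -> seq_mset t = m ->
    tval t = sort leq m.
  move=> t_s def_m; apply: (sorted_eq leq_trans anti_leq) => //.
    exact/sort_sorted/leq_total.
  by rewrite perm_sym perm_sort -def_m perm_eq_seq_mset.
rewrite /F; case: eqP => [sz_m|ne_m] /=; last first.
  apply: fsbig1 => t [t_s _]; case: eqP => // def_m.
  by case: ne_m; rewrite -def_m (perm_size (perm_eq_seq_mset t)) size_tuple.
have sz_t0 : size (sort leq m) == n by rewrite size_sort sz_m.
pose t0 := Tuple sz_t0.
have def_m : seq_mset t0 = m.
  by rewrite -[RHS]seq_mset_id; apply/eq_seq_msetP; rewrite /= perm_sort.
rewrite compatible_Des //; case: forall_inP => [t0_S|t0_S].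
  rewrite -(@fsbig_widen _ _ _ _ [set t0]) => [|t /= ->|t [[t_s _] /= ne_t]].
  - by rewrite fsbig_set1 def_m eqxx.
  - by split=> //; apply/sort_sorted/leq_total.
  case: eqP => // /(only t t_s) def_t; case: ne_t; exact: val_inj.
apply: fsbig1 => t [t_s t_S]; case: eqP => // /(only t t_s) def_t.
by case: t0_S => j /t_S; rewrite def_t.
Qed.

Lemma Q_coef (R : realType) n k (Pi : {set 'S_k}) (m : {mset nat}) :
  Q R n Pi m = ((size m == n) * coef n Pi m)%:R.
Proof.
rewrite /Q /coef -(seq.permP (perm_oneline_enum n)) count_map.
rewrite (eq_bigr _ (fun s _ => F_coef R s m)) -natr_sum; congr _%:R.
rewrite -sum1_count big_enum_cond /= big_distrr /= [LHS]big_mkcond [RHS]big_mkcond.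
apply: eq_bigr => s _; rewrite inE /avoids.
rewrite (eq_forallb_in (P2 := fun p => ~~ has_pattern (oneline p) (oneline s))) => [|p _].
  by case: ifP => _; rewrite ?andbT ?andbF //; case: eqP => //; case: compatible.
by rewrite contains_has_pattern.
Qed.

Lemma coef_perm n k (Pi : {set 'S_k}) t t' : perm_eq t t' -> coef n Pi t = coef n Pi t'.
Proof.
move=> ptt'; apply: eq_count => u; rewrite /compatible; congr (sorted _ (zip _ _) && _).
by apply/perm_sortP => //; [exact: leq_total | exact: leq_trans | exact: anti_leq].
Qed.

Lemma symmetric_Q_coef (R : realType) n k (Pi : {set 'S_k}) :
  symmetric_function (Q R n Pi) <->
  forall (w : nat -> nat) t, bijective w -> size t = n ->
    coef n Pi (map w t) = coef n Pi t.
Proof.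
have perm_rename w (m : {mset nat}) : perm_eq (rename_vars w m) (map w m).
  exact: perm_eq_seq_mset.
split=> [[_ symQ] w t w_bij sz_t|sym_coef]; last split.
- have := symQ w w_bij (seq_mset t); rewrite !Q_coef => /eqP; rewrite eqr_nat.
  rewrite (perm_size (perm_rename _ _)) size_map.
  rewrite (perm_size (perm_eq_seq_mset t)) sz_t eqxx !mul1n.
  rewrite (coef_perm _ _ (perm_rename _ _)) => /eqP.
  rewrite (coef_perm _ _ (perm_eq_seq_mset t)) => <-; apply: coef_perm.
  by rewrite perm_sym perm_map // perm_eq_seq_mset.
- by exists n => m; rewrite Q_coef; case: eqP => [->|_] //; rewrite mul0n.
move=> w w_bij m; rewrite !Q_coef (perm_size (perm_rename _ _)) size_map.
by case: eqP => [sz_m|] //; rewrite (coef_perm _ _ (perm_rename _ _)) sym_coef.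
Qed.
End Coefficients.

Lemma coef_word_count n k (Pi : {set 'S_k}) (P : pred (seq nat)) t :
  (forall w, avoids Pi (inv_std w) = P w) -> size t = n ->
  coef n Pi t = word_count P t.
Proof.
move=> PiP <-; rewrite /coef -(@eq_count _ (predI (avoids Pi) (compatible t))).
  rewrite -count_filter -(seq.permP (perm_inv_std t)) count_map.
  by apply: eq_count => w /=; apply: PiP.
by move=> u /=; apply: andbC.
Qed.

Lemma coef_rename n k (Pi : {set 'S_k}) (P : pred (seq nat)) (f : nat -> nat) t :
  crystal_invariant P -> (forall w, avoids Pi (inv_std w) = P w) ->
  injective f -> size t = n -> coef n Pi (map f t) = coef n Pi t.
Proof.
move=> P_inv PiP f_inj sz_t.
by rewrite !(coef_word_count PiP) ?size_map // word_count_rename.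
Qed.

Lemma coef_set0_rename n k (f : nat -> nat) t :
  injective f -> size t = n ->
  coef n (set0 : {set 'S_k}) (map f t) = coef n (set0 : {set 'S_k}) t.
Proof.
apply: (@coef_rename _ _ _ xpredT) => // w.
by apply/forall_inP => p; rewrite inE.
Qed.

Lemma oneline_iota k : oneline (iota_perm k) = iota 1 k.
Proof.
apply: (@eq_from_nth _ 0) => [|i]; rewrite size_oneline ?size_iota // => lt_ik.
by rewrite (nth_oneline _ (Ordinal lt_ik)) perm1 nth_iota.
Qed.

Lemma oneline_delta k : oneline (delta_perm k) = rev (iota 1 k).
Proof.
apply: (@eq_from_nth _ 0) => [|i]; rewrite size_oneline ?size_rev ?size_iota // => lt_ik.
rewrite (nth_oneline _ (Ordinal lt_ik)) permE nth_rev size_iota // nth_iota /=; lia.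
Qed.

Lemma avoids_iota_delta k u :
  avoids [set iota_perm k; delta_perm k] u = ~~ has_strict_chain k u.
Proof.
have pat_i : has_pattern (oneline (iota_perm k)) u =
    has (fun x => (size x == k) && sorted ltn x) (subseqs u).
  by rewrite oneline_iota; apply: eq_has => x; apply: standardization_iota.
have pat_d : has_pattern (oneline (delta_perm k)) u =
    has (fun x => (size x == k) && sorted gtn x) (subseqs u).
  by rewrite oneline_delta; apply: eq_has => x; apply: standardization_rev_iota.
have -> : has_strict_chain k u = has_pattern (oneline (iota_perm k)) u ||
                                 has_pattern (oneline (delta_perm k)) u.
  by rewrite pat_i pat_d -has_predU; apply: eq_has => x /=; rewrite andb_orr.
apply/forall_inP/norP => [av|[av_i av_d] p]; first by split; apply: av; rewrite !inE eqxx ?orbT.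
by rewrite !inE => /orP[]/eqP->.
Qed.

Lemma symmetric_iota_delta (R : realType) n k :
  symmetric_function (Q R n [set iota_perm k; delta_perm k]).
Proof.
apply/symmetric_Q_coef => w t /bij_inj w_inj.
apply: (@coef_rename _ _ _ (predC (has_chain k))) => //.
  by move=> a u u_gt0 /=; rewrite has_chain_crystal_invariant.
by move=> u; rewrite avoids_iota_delta has_strict_chain_inv_std.
Qed.

(** * Two patterns in degree k *)

Lemma has_pattern_full k p u : perm_eq u (iota 1 k) -> perm_eq p (iota 1 k) ->
  has_pattern p u = (u == p).
Proof.
move=> pu pp; have sz : size p = size u by rewrite (perm_size pp) (perm_size pu).
apply/hasP/eqP => [[x + /eqP std_x]|def_u].
  rewrite mem_subseqs => x_u.
  have sz_x : size x = size u by rewrite -(size_standardization x) std_x.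
  have /eqP def_x : x == u by rewrite -(size_subseq_leqif x_u) sz_x.
  by rewrite -std_x def_x (standardization_id pu).
by exists u; rewrite ?mem_subseqs ?subseq_refl // -def_u (standardization_id pu).
Qed.

Lemma count_disjointU (T : eqType) (P P1 P2 : pred T) s :
  {in s, forall x, P1 x + P2 x = P x} -> count P1 s + count P2 s = count P s.
Proof.
elim: s => //= x s IHs sP; rewrite -sP ?mem_head // -IHs => [|y ys]; first by lia.
by rewrite sP // inE ys orbT.
Qed.

(** In length [k] a permutation contains a pattern of length [k] only if it is
    that pattern, so avoiding the pair removes exactly two permutations. *)
Lemma coef_pair_complement k (p1 p2 : 'S_k) t : p1 != p2 ->
  coef k [set p1; p2] t + (compatible t (oneline p1) + compatible t (oneline p2)) =
  coef k (finset.set0 : {set 'S_k}) t.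
Proof.
move=> ne_p; have ne_u : oneline p1 != oneline p2 by rewrite (inj_eq (@oneline_inj k)).
have one (p : 'S_k) :
    nat_of_bool (compatible t (oneline p)) =
    count (fun u => (u == oneline p) && compatible t u) (permutations (iota 1 k)).
  transitivity (count (fun u => (u == oneline p) && compatible t (oneline p))
                      (permutations (iota 1 k))); last first.
    by apply: eq_count => u /=; case: eqP => // ->.
  case: compatible; last by rewrite -(@eq_count _ xpred0) ?count_pred0 // => u; rewrite andbF.
  rewrite (@eq_count _ _ (pred1 (oneline p))) => [|u /=]; last by rewrite andbT.
  by rewrite count_uniq_mem ?permutations_uniq // mem_permutations oneline_perm.
rewrite !one (@count_disjointU _
  (fun u => ((u == oneline p1) || (u == oneline p2)) && compatible t u)) => [|u _]; last first.
  by case: (u =P oneline p1) => [->|_] //=; rewrite (negbTE ne_u) addn0.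
apply: count_disjointU => u; rewrite mem_permutations => pu /=.
have -> : avoids (finset.set0 : {set 'S_k}) u by apply/forall_inP => p; rewrite inE.
have -> : avoids [set p1; p2] u = ~~ ((u == oneline p1) || (u == oneline p2)).
  apply/forall_inP/norP => [av|[av1 av2] p].
    by split; rewrite -(has_pattern_full pu) ?oneline_perm //; apply: av; rewrite !inE eqxx ?orbT.
  by rewrite !inE => /orP[]/eqP->; rewrite (has_pattern_full pu) ?oneline_perm.
by case: compatible; case: orb.
Qed.

(** The symmetric function [F_{Des p1} + F_{Des p2}], coefficient by coefficient. *)
Lemma symmetric_pair_compatible (R : realType) k (p1 p2 : 'S_k) (f : nat -> nat) t :
  p1 != p2 -> symmetric_function (Q R k [set p1; p2]) -> bijective f -> size t = k ->
  compatible (map f t) (oneline p1) + compatible (map f t) (oneline p2) =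
  compatible t (oneline p1) + compatible t (oneline p2).
Proof.
move=> ne_p /symmetric_Q_coef symQ f_bij sz_t.
apply: (@addnI (coef k [set p1; p2] t)); rewrite -{1}(symQ f t) // !coef_pair_complement //.
by rewrite coef_set0_rename //; apply: bij_inj.
Qed.

Lemma compatible_sorted t v u : perm_eq t v -> sorted leq v ->
  compatible t u = sorted lex (zip v u).
Proof.
move=> ptv v_s; rewrite /compatible; congr (sorted _ (zip _ _)).
apply: (sorted_eq leq_trans anti_leq) => //; first exact/sort_sorted/leq_total.
by rewrite perm_sort.
Qed.

Lemma compatible_perm t t' u : perm_eq t t' -> compatible t u = compatible t' u.
Proof.
move=> ptt'; rewrite (@compatible_sorted t (sort leq t')) //; last first.
  exact/sort_sorted/leq_total.
by rewrite perm_sym perm_sort perm_sym.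
Qed.

Definition asc (u : seq nat) i := nth 0 u i <= nth 0 u i.+1.

Lemma map_sub_iota d m n : [seq x - d | x <- iota (d + m) n] = iota m n.
Proof. by rewrite iotaDl -map_comp -[RHS]map_id; apply: eq_map => x /=; lia. Qed.

Lemma iota_last m n : iota m n.+1 = iota m n ++ [:: m + n].
Proof. by rewrite -addn1 iotaD. Qed.

(** One repeated letter tests a single position. *)
Lemma compatible_double k u i : size u = k.+1 -> i < k ->
  compatible (i :: iota 0 k) u = asc u i.
Proof.
move=> sz_u lt_ik; pose v := mkseq (fun x => x - (i < x)) k.+1.
have ptv : perm_eq (i :: iota 0 k) v.
  rewrite /v /mkseq (_ : k.+1 = i.+1 + (k - i)); last lia.
  rewrite iotaD map_cat add0n.
  have -> : [seq x - (i < x) | x <- iota i.+1 (k - i)] = iota i (k - i).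
    rewrite -[RHS](map_sub_iota 1); apply/eq_in_map => x; rewrite mem_iota; lia.
  have -> : [seq x - (i < x) | x <- iota 0 i.+1] = iota 0 i ++ [:: i].
    transitivity (iota 0 i.+1); last exact: iota_last.
    by rewrite -[RHS]map_id; apply/eq_in_map => x; rewrite mem_iota; lia.
  rewrite {1}(_ : k = i + (k - i)) ?iotaD; last lia.
  by apply/seq.permP => P; rewrite /= !count_cat /= add0n; lia.
have v_s : sorted leq v.
  by apply/(sortedP 0) => x; rewrite size_mkseq => lt_x; rewrite !nth_mkseq; lia.
have sz_vu : size v = size u by rewrite size_mkseq.
rewrite (compatible_sorted _ ptv v_s); apply/(sortedP (0, 0))/idP.
  rewrite size_zip sz_vu minnn sz_u => /(_ i lt_ik).
  by rewrite !nth_zip // !nth_mkseq /lex /= -/(asc u i); lia.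
move=> asc_i x; rewrite size_zip sz_vu minnn sz_u => lt_x.
rewrite !nth_zip // !nth_mkseq /lex /= -/(asc u x); try lia.
by case: (eqVneq x i) => [->|]; lia.
Qed.

(** Two repeated letters test two positions: adjacent ones when [i = j], where the
    letter has multiplicity three, and otherwise positions at distance at least
    two. *)
Lemma compatible_double2 k u i j : size u = k.+2 -> i <= j < k ->
  compatible [:: i, j & iota 0 k] u = asc u i && asc u j.+1.
Proof.
move=> sz_u /andP[le_ij lt_jk]; pose v := mkseq (fun x => x - (i < x) - (j.+1 < x)) k.+2.
have ptv : perm_eq [:: i, j & iota 0 k] v.
  rewrite /v /mkseq (_ : k.+2 = i.+1 + ((j - i).+1 + (k - j))); last lia.
  rewrite 2!iotaD !map_cat add0n.
  have -> : [seq x - (i < x) - (j.+1 < x) | x <- iota (i.+1 + (j - i).+1) (k - j)] =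
            iota j (k - j).
    rewrite -[RHS](map_sub_iota 2) (_ : i.+1 + (j - i).+1 = 2 + j); last lia.
    by apply/eq_in_map => x; rewrite mem_iota; lia.
  have -> : [seq x - (i < x) - (j.+1 < x) | x <- iota i.+1 (j - i).+1] =
            iota i (j - i) ++ [:: j].
    transitivity (iota i (j - i).+1); last by rewrite iota_last subnKC.
    rewrite -[RHS](map_sub_iota 1).
    by apply/eq_in_map => x; rewrite mem_iota; lia.
  have -> : [seq x - (i < x) - (j.+1 < x) | x <- iota 0 i.+1] = iota 0 i ++ [:: i].
    transitivity (iota 0 i.+1); last exact: iota_last.
    by rewrite -[RHS]map_id; apply/eq_in_map => x; rewrite mem_iota; lia.
  rewrite {1}(_ : k = i + ((j - i) + (k - j))); last lia.
  rewrite !iotaD add0n subnKC //.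
  by apply/seq.permP => P; rewrite /= !count_cat /=; lia.
have v_s : sorted leq v.
  by apply/(sortedP 0) => x; rewrite size_mkseq => lt_x; rewrite !nth_mkseq; lia.
have sz_vu : size v = size u by rewrite size_mkseq.
rewrite (compatible_sorted _ ptv v_s); apply/(sortedP (0, 0))/andP.
  rewrite size_zip sz_vu minnn sz_u => v_lex; split.
    have := v_lex i; rewrite !nth_zip // !nth_mkseq /lex /= -/(asc u i); lia.
  have := v_lex j.+1; rewrite !nth_zip // !nth_mkseq /lex /= -/(asc u j.+1); lia.
move=> [asc_i asc_j] x; rewrite size_zip sz_vu minnn sz_u => lt_x.
rewrite !nth_zip // !nth_mkseq /lex /= -/(asc u x); try lia.
case: (eqVneq x i) => [->|]; first by rewrite asc_i; lia.
by case: (eqVneq x j.+1) => [->|]; lia.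
Qed.

Lemma perm_swap_iota x y m : x < m -> y < m -> perm_eq (map (swap x y) (iota 0 m)) (iota 0 m).
Proof.
move=> lt_x lt_y; apply/allP => z _ /=; rewrite count_map_swap !count_uniq_mem ?iota_uniq //.
rewrite !mem_iota /= !add0n /swap; case: (z =P x) => [->|_]; first by rewrite lt_x lt_y.
by case: (z =P y) => [->|_]; rewrite ?lt_x ?lt_y.
Qed.

Lemma swap_bij x y : bijective (swap x y).
Proof. exact: inv_bij (swapK x y). Qed.

(** * The alternating case in degree 6 *)

Definition patterns4 (u : seq nat) :=
  [seq standardization x | x <- subseqs u & size x == 4].

(** One row for each compatible permutation, so that its patterns are computed once
    and then compared with all pairs. *)
Definition table6 (t : seq nat) :=
  [seq patterns4 u | u <- permutations (iota 1 6) & compatible t u].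

Definition count_avoid (T : seq (seq (seq nat))) (p q : seq nat) :=
  count (fun P => (p \notin P) && (q \notin P)) T.

(** The three tables belong to three exponent vectors that are rearrangements of
    each other, so symmetry would force equal counts. *)
Definition separates (T1 T2 T3 : seq (seq (seq nat))) :=
  all (fun p => all (fun q =>
      ~~ ((count_avoid T2 p q == count_avoid T1 p q) &&
          (count_avoid T3 p q == count_avoid T2 p q)))
    [seq q <- permutations (iota 1 4) | [&& ~~ asc q 0, asc q 1 & ~~ asc q 2]])
  [seq p <- permutations (iota 1 4) | [&& asc p 0, ~~ asc p 1 & asc p 2]].

Lemma separated :
  separates (table6 [:: 0; 1; 2; 2; 3; 3]) (table6 [:: 0; 1; 1; 2; 3; 3])
            (table6 [:: 0; 1; 1; 2; 2; 3]).
Proof. by vm_compute. Qed.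

Lemma separatesP T1 T2 T3 p q : separates T1 T2 T3 ->
  perm_eq p (iota 1 4) -> perm_eq q (iota 1 4) ->
  [&& asc p 0, ~~ asc p 1 & asc p 2] -> [&& ~~ asc q 0, asc q 1 & ~~ asc q 2] ->
  ~ (count_avoid T2 p q = count_avoid T1 p q /\ count_avoid T3 p q = count_avoid T2 p q).
Proof.
move=> /allP/(_ p) + pp pq asc_p asc_q [eq_T2 eq_T3].
rewrite mem_filter asc_p mem_permutations pp => /(_ isT)/allP/(_ q).
by rewrite mem_filter asc_q mem_permutations pq => /(_ isT); rewrite eq_T3 eq_T2 eqxx.
Qed.

Lemma has_pattern4 p u : size p = 4 -> has_pattern p u = (p \in patterns4 u).
Proof.
move=> sz_p; apply/hasP/mapP => [[x x_u /eqP std_x]|[x + ->]].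
  exists x; rewrite ?std_x // mem_filter x_u andbT.
  by rewrite -(size_standardization x) std_x sz_p.
by rewrite mem_filter => /andP[_ x_u]; exists x; rewrite ?eqxx.
Qed.

Lemma coef_count_avoid (p q : 'S_4) t :
  coef 6 [set p; q] t = count_avoid (table6 t) (oneline p) (oneline q).
Proof.
rewrite /coef /count_avoid /table6 count_map count_filter; apply: eq_count => u /=.
rewrite andbC; congr (_ && _); rewrite -!has_pattern4 ?size_oneline //.
apply/forall_inP/andP => [av|[av_p av_q] r]; first by split; apply: av; rewrite !inE eqxx ?orbT.
by rewrite !inE => /orP[]/eqP->.
Qed.

Lemma symmetric_coef_rename (R : realType) n k (Pi : {set 'S_k}) f t t' :
  symmetric_function (Q R n Pi) -> bijective f -> size t = n -> perm_eq (map f t) t' ->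
  coef n Pi t' = coef n Pi t.
Proof.
by move=> /symmetric_Q_coef symQ f_bij sz_t ptt'; rewrite -(symQ f t) // (coef_perm _ _ ptt').
Qed.

Lemma alternating_not_symmetric (R : realType) k (p q : 'S_k) : k = 4 ->
  [&& asc (oneline p) 0, ~~ asc (oneline p) 1 & asc (oneline p) 2] ->
  [&& ~~ asc (oneline q) 0, asc (oneline q) 1 & ~~ asc (oneline q) 2] ->
  ~ symmetric_function (Q R 6 [set p; q]).
Proof.
move=> k4; subst k => asc_p asc_q symQ.
have eq12 := symmetric_coef_rename (t := [:: 0; 1; 2; 2; 3; 3])
  (t' := [:: 0; 1; 1; 2; 3; 3]) symQ (swap_bij 1 2) erefl isT.
have eq23 := symmetric_coef_rename (t := [:: 0; 1; 1; 2; 3; 3])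
  (t' := [:: 0; 1; 1; 2; 2; 3]) symQ (swap_bij 2 3) erefl isT.
move: eq12 eq23; rewrite !coef_count_avoid => eq12 eq23.
exact (separatesP separated (oneline_perm p) (oneline_perm q) asc_p asc_q (conj eq12 eq23)).
Qed.

(** * Pairs with complementary ascents *)

Lemma asc_iota k u : perm_eq u (iota 1 k) -> (forall i, i.+1 < k -> asc u i) -> u = iota 1 k.
Proof.
move=> pu u_asc; apply: (sorted_eq leq_trans anti_leq); rewrite ?iota_sorted //.
by apply/(sortedP 0) => i; rewrite (perm_size pu) size_iota; apply: u_asc.
Qed.

Lemma desc_rev_iota k u : perm_eq u (iota 1 k) -> (forall i, i.+1 < k -> ~~ asc u i) ->
  u = rev (iota 1 k).
Proof.
move=> pu u_desc; rewrite -[LHS]revK; congr rev.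
apply: (sorted_eq leq_trans anti_leq); rewrite ?iota_sorted ?perm_rev //.
rewrite rev_sorted; apply/(sortedP 0) => i; rewrite (perm_size pu) size_iota => /u_desc.
by rewrite -ltnNge; apply: ltnW.
Qed.

(** The combinatorial core: [a] and [b] are the ascent indicators of the two
    permutations, and the hypotheses compare coefficients at renamed monomials
    with one doubled letter, one tripled letter, and two doubled letters. *)
Lemma complementary_ascents k (a b : nat -> bool) : 4 <= k ->
  (forall i j, i.+1 < k -> j.+1 < k -> a i + b i = a j + b j) ->
  (forall i j, i.+2 < k -> j.+2 < k ->
     (a i && a i.+1) + (b i && b i.+1) = (a j && a j.+1) + (b j && b j.+1)) ->
  (4 < k -> (a 0 && a 2) + (b 0 && b 2) = (a 0 && a 3) + (b 0 && b 3)) ->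
  (forall i, i.+1 < k -> a i = a 0 /\ b i = b 0) \/
  [/\ k = 4, a 1 = ~~ a 0, a 2 = a 0 & forall i, i < 3 -> b i = ~~ a i].
Proof.
move=> k4 ab1 ab2 ab3; have lt1k : 1 < k by lia.
have lt2k : 2 < k by lia.
have [eq_ab|ne_ab] := eqVneq (a 0) (b 0).
  by left=> i lt_i; have := ab1 i 0 lt_i lt1k; rewrite -eq_ab; case: (a 0) (a i) (b i) => [] [] [].
have def_b i : i.+1 < k -> b i = ~~ a i.
  move=> lt_i; have := ab1 i 0 lt_i lt1k; move: ne_ab.
  by case: (a 0) (b 0) (a i) (b i) => [] [] [] [].
have step i : i.+2 < k -> (a i == a i.+1) = (a 0 == a 1).
  move=> lt_i; have := ab2 i 0 lt_i lt2k; rewrite !def_b //; last lia.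
  by case: (a 0) (a 1) (a i) (a i.+1) => [] [] [] [].
(* If the first two ascents agree, the tripled letter propagates this to all
   positions; otherwise they alternate. *)
have [eq_a01|ne_a01] := eqVneq (a 0) (a 1).
  have a_const i : i.+1 < k -> a i = a 0.
    elim: i => // i IHi lt_i; rewrite -IHi; last lia.
    by apply/esym/eqP; rewrite step // eq_a01 eqxx.
  by left=> i lt_i; rewrite !def_b ?a_const //; lia.
have neg i : i.+2 < k -> a i.+1 = ~~ a i.
  by move=> /step; rewrite (negbTE ne_a01); case: (a i) (a i.+1) => [] [].
have a1 : a 1 = ~~ a 0 by apply: neg; lia.
have a2 : a 2 = a 0 by rewrite neg ?a1 ?negbK; lia.
right; split=> // [|i lt_i]; last by apply: def_b; lia.
(* Alternation puts positions 0 and 2 on the same side, 0 and 3 on opposite ones. *)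
apply/eqP; rewrite eqn_leq k4 andbT leqNgt; apply/negP => k5.
have := ab3 k5; rewrite !def_b ?(neg 2) ?a2; lia.
Qed.

Theorem theorem2p4 (R : realType) (k : nat) (Pi : {set 'S_k}) :
  4 <= k -> #|Pi| = 2 ->
  (forall n : nat, symmetric_function (Q R n Pi)) <->
  Pi = [set iota_perm k; delta_perm k].
Proof.
move=> k4 /eqP/cards2P[p [q [ne_pq ->]]]; split=> [symQ|-> n]; last exact: symmetric_iota_delta.
set u := oneline p; set v := oneline q.
have sz_u : size u = k by apply: size_oneline.
have sz_v : size v = k by apply: size_oneline.
have shift t t' f : bijective f -> size t = k -> perm_eq (map f t) t' ->
    compatible t' u + compatible t' v = compatible t u + compatible t v.
  move=> f_bij sz_t ptt'; rewrite -!(compatible_perm _ ptt').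
  exact: (symmetric_pair_compatible ne_pq (symQ k)).
have := @complementary_ascents k (asc u) (asc v) k4.
case=> [i j lt_i lt_j|i j lt_i lt_j|k5||].
- rewrite -!(@compatible_double k.-1); try lia.
  apply: (shift _ _ _ (swap_bij j i)); rewrite /= ?size_iota; first lia.
  by rewrite swapL perm_cons perm_swap_iota; lia.
- rewrite -!(@compatible_double2 k.-2); try lia.
  apply: (shift _ _ _ (swap_bij j i)); rewrite /= ?size_iota; first lia.
  by rewrite swapL !perm_cons perm_swap_iota; lia.
- rewrite -!(@compatible_double2 k.-2); try lia.
  apply: (shift _ _ _ (swap_bij 2 1)); rewrite /= ?size_iota; first lia.
  by rewrite !perm_cons perm_swap_iota; lia.
- move=> const.
  have mono (r : 'S_k) : (forall i, i.+1 < k -> asc (oneline r) i = asc (oneline r) 0) ->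
      r = if asc (oneline r) 0 then iota_perm k else delta_perm k.
    move=> r_const; apply: oneline_inj; case: ifP => r0.
      by rewrite oneline_iota; apply: asc_iota (oneline_perm r) _ => i /r_const->.
    by rewrite oneline_delta; apply: desc_rev_iota (oneline_perm r) _ => i /r_const->; rewrite r0.
  have def_p := mono p (fun i lt_i => (const i lt_i).1).
  have def_q := mono q (fun i lt_i => (const i lt_i).2).
  move: ne_pq; rewrite def_p def_q; do 2!case: ifP => _; rewrite ?eqxx //.
  by rewrite finset.setUC.
case=> k_4 u1 u2 def_v; have [v0 v1 v2] :
  [/\ asc v 0 = ~~ asc u 0, asc v 1 = asc u 0 & asc v 2 = ~~ asc u 0].
  by rewrite !def_v // u1 u2 negbK.
have [u0|nu0] := boolP (asc u 0).
  case: (@alternating_not_symmetric R k p q k_4 _ _ (symQ 6)).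
    by rewrite -/u u1 u2 u0.
  by rewrite -/v v0 v1 v2 u0.
case: (@alternating_not_symmetric R k q p k_4); last by rewrite finset.setUC.
  by rewrite -/v v0 v1 v2 (negbTE nu0).
by rewrite -/u u1 u2 (negbTE nu0).
Qed.
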